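(* Let $\mathcal M$ be a minimal time-like surface of general type in $\mathbb R^4_2$, parametrized by isothermal coordinates $(u,v)$ with $E<0$, and let $\sigma$ be its second fundamental form. If $\mathcal M$ is of the first or the second type, then these coordinates are canonical if and only if \[ \sigma(x_u,x_u)\perp\sigma(x_u,x_v),\qquad \sigma^2(x_u,x_u)+\sigma^2(x_u,x_v)=\pm1, \] where the sign ''$+$'' is for surfaces of the first type and the sign ''$-$'' is for surfaces of the second type. If $\mathcal M$ is of the third type, then these coordinates are canonical if and only if \[ 2\,\sigma(x_u,x_u)\cdot\sigma(x_u,x_v)=1,\qquad \sigma^2(x_u,x_u)+\sigma^2(x_u,x_v)=0 . \]
   Context: All maps are smooth and domains are open and connected. $\mathbb R^4_2$ is $\mathbb R^4$ with scalar product $a\cdot b=-a_1b_1+a_2b_2-a_3b_3+a_4b_4$; $a^2=a\cdot a$, and $\sigma^2(X,Y)=\sigma(X,Y)\cdot\sigma(X,Y)$. Double numbers: $\mathbb D=\{t=u+\mathrm jv:u,v\in\mathbb R\}$, $\mathrm j^2=1$, $\bar t=u-\mathrm jv$, $|t|^2=t\bar t=u^2-v^2$; $\mathbb D_0=\{t:|t|^2=0\}$; $\mathbb D_+=\{t:|t|^2>0,\ \mathrm{Re}\,t>0\}$; $\frac{\partial}{\partial t}=\frac12(\frac{\partial}{\partial u}+\mathrm j\frac{\partial}{\partial v})$. $\mathbb D^4_2$ is $\mathbb D^4$ with the $\mathbb D$-bilinear extension of the scalar product. A time-like surface $\mathcal M=(\mathcal D,x)$ is an immersion $x:\mathcal D\to\mathbb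 R^4_2$, $\mathcal D\subset\mathbb R^2$, whose induced scalar product on tangent planes is indefinite (signature $(1,1)$). Coordinates $(u,v)$ are isothermal if $x_u^2=-x_v^2$ and $x_u\cdot x_v=0$; $E=x_u^2$. The surface is minimal if $\frac12(-\sigma(X_1,X_1)+\sigma(X_2,X_2))=0$, where $(X_1,X_2)$ is an orthonormal tangent frame with $X_1^2=-1$, $X_2^2=1$. For isothermal $t=u+\mathrm jv$ put $\Phi=x_u+\mathrm jx_v$ and $\Phi'=\partial\Phi/\partial t$; $\Phi'^\bot$ is the projection of $\Phi'$ to the complexified normal space (the $\mathbb D$-span of the normal space), along the complexified tangent space, and ${\Phi'^\bot}^2=\Phi'^\bot\cdot\Phi'^\bot\in\mathbb D$. A minimal time-like surface is of general type if ${\Phi'^\bot}^2\notin\mathbb D_0$ at every point; it is of the first type if ${\Phi'^\bot}^2\in\mathbb D_+$, of the second type if $-{\Phi'^\bot}^2\in\mathbb D_+$, of the third type if $\pm\mathrm j{\Phi'^\bot}^2\in\mathbb D_+$ (i.e. $|{\Phi'^\bot}^2|^2<0$). Isothermal coordinates with $E<0$ are canonical if ${\Phi'^\bot}^2=\varepsilon$, where $\varepsilon=1,-1,\mathrm j$ for surfaces of the first, second, third type, respectively. *)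

(* Defs.v *)
From HB Require Import structures.
From mathcomp Require Import all_boot all_order all_algebra.
From mathcomp Require Import all_classical all_reals all_analysis.
From mathcomp Require Import ring.

Set Implicit Arguments.
Unset Strict Implicit.
Unset Printing Implicit Defensive.

Import Order.TTheory GRing.Theory Num.Theory.
Import numFieldNormedType.Exports.

Local Open Scope classical_set_scope.
Local Open Scope ring_scope.

(* Double numbers [u + j v], with [j ^+ 2 = 1]. *)

Record dnum (R : Type) : Type := Dnum { dnRe : R; dnIm : R }.

Section DnumChoice.
Variable R : Type.
Definition pair_of_dnum (t : dnum R) := (dnRe t, dnIm t).
Definition dnum_of_pair (a : R * R) := Dnum a.1 a.2.
Lemma pair_of_dnumK : cancel pair_of_dnum dnum_of_pair.
Proof. by case. Qed.
End DnumChoice.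

HB.instance Definition _ (R : eqType) := Equality.copy (dnum R)
  (can_type (@pair_of_dnumK R)).
HB.instance Definition _ (R : choiceType) := Choice.copy (dnum R)
  (can_type (@pair_of_dnumK R)).

Section DnumRing.
Variable R : comNzRingType.
Implicit Types s t : dnum R.

Definition dn_add s t := Dnum (dnRe s + dnRe t) (dnIm s + dnIm t).
Definition dn_opp t := Dnum (- dnRe t) (- dnIm t).
Definition dn_mul s t :=
  Dnum (dnRe s * dnRe t + dnIm s * dnIm t) (dnRe s * dnIm t + dnIm s * dnRe t).

Lemma dn_addA : associative dn_add.
Proof. by move=> r s t; rewrite /dn_add /= !addrA. Qed.
Lemma dn_addC : commutative dn_add.
Proof. by move=> s t; congr Dnum; rewrite addrC. Qed.
Lemma dn_add0 : left_id (Dnum 0 0) dn_add.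
Proof. by case=> u v; rewrite /dn_add /= !add0r. Qed.
Lemma dn_addN : left_inverse (Dnum 0 0) dn_opp dn_add.
Proof. by move=> t; rewrite /dn_add /= !addNr. Qed.

HB.instance Definition _ :=
  GRing.isZmodule.Build (dnum R) dn_addA dn_addC dn_add0 dn_addN.

Lemma dn_mulA : associative dn_mul.
Proof. by move=> r s t; congr Dnum; rewrite /=; ring. Qed.
Lemma dn_mulC : commutative dn_mul.
Proof.
move=> s t; rewrite /dn_mul; congr Dnum.
  by rewrite mulrC [dnIm s * _]mulrC.
by rewrite addrC mulrC [dnRe s * _]mulrC.
Qed.
Lemma dn_mul1 : left_id (Dnum 1 0) dn_mul.
Proof. by case=> u v; rewrite /dn_mul /= !mul1r !mul0r !addr0. Qed.
Lemma dn_mulDl : left_distributive dn_mul dn_add.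
Proof. by move=> r s t; congr Dnum; rewrite /=; ring. Qed.
Lemma dn_1neq0 : Dnum 1 0 != 0 :> dnum R.
Proof. by apply/eqP => -[] /eqP; rewrite oner_eq0. Qed.

HB.instance Definition _ := GRing.Zmodule_isComNzRing.Build (dnum R)
  dn_mulA dn_mulC dn_mul1 dn_mulDl dn_1neq0.

Definition dn_of (a : R) : dnum R := Dnum a 0.
Definition dn_j : dnum R := Dnum 0 1.
Definition dn_conj t : dnum R := Dnum (dnRe t) (- dnIm t).
Definition dn_sqnorm t : R := dnRe t ^+ 2 - dnIm t ^+ 2.

Lemma dnumE t : t = dn_of (dnRe t) + dn_j * dn_of (dnIm t).
Proof.
case: t => u v; congr Dnum; rewrite /= ?(mul0r, mul1r, mulr0, addr0, add0r) //.
Qed.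

Lemma dn_jj : dn_j ^+ 2 = 1.
Proof. by congr Dnum; rewrite /= ?(mul0r, mul1r, mulr0, addr0, add0r). Qed.

Lemma dn_sqnormE t : t * dn_conj t = dn_of (dn_sqnorm t).
Proof.
congr Dnum; first by rewrite /= mulrN -!expr2.
by rewrite /= mulrN [dnIm t * _]mulrC addNr.
Qed.

End DnumRing.
Arguments dn_j {R}.

Definition dn_null (R : realType) : set (dnum R) := [set t | dn_sqnorm t = 0].
Definition dn_pos (R : realType) : set (dnum R) :=
  [set t | 0 < dn_sqnorm t /\ 0 < dnRe t].

(* The diagonal is (-1, 1, -1, 1). *)
Definition metric_mx (K : nzRingType) : 'M[K]_4 :=
  diag_mx (\row_(i < 4) (-1) ^+ i.+1).

(* For [K := dnum R] this is the bilinear extension of the case [K := R]. *)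
Definition sdot (K : nzRingType) (a b : 'rV[K]_4) : K :=
  (a *m metric_mx K *m b^T) 0 0.

Lemma sdotE (K : nzRingType) (a b : 'rV[K]_4) :
  sdot a b = - (a 0 0 * b 0 0) + a 0 1 * b 0 1
             - a 0 2%:R * b 0 2%:R + a 0 3%:R * b 0 3%:R.
Proof.
have -> : sdot a b = \sum_i a 0 i * (-1) ^+ i.+1 * b 0 i.
  by rewrite /sdot mul_mx_diag mxE; apply: eq_bigr => i _; rewrite !mxE.
rewrite !big_ord_recl big_ord0 addr0 !addrA.
have e (i j : 'I_4) : val i = val j -> a 0 i * b 0 i = a 0 j * b 0 j.
  by move/val_inj->.
rewrite /= !exprS expr0 !(mulN1r, mulrN1, opprK, mulr1, mulNr, mulrN).
by congr (- _ + _ - _ + _); apply: e.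
Qed.

Section Surface.
Variable R : realType.
Implicit Types (U : set 'rV[R]_2) (x : 'rV[R]_2 -> 'rV[R]_4) (p : 'rV[R]_2).

Definition partial (V : normedModType R) (i : 'I_2) (f : 'rV[R]_2 -> V) :
  'rV[R]_2 -> V := fun p => 'D_(delta_mx 0 i) f p.

(* All iterated partial derivatives exist and are differentiable, hence
   continuous, at every point of [U]. *)
Definition smooth_on U x : Prop :=
  forall (s : seq 'I_2) p, U p -> differentiable (foldr (@partial _) x s) p.

Definition x_u x p : 'rV[R]_4 := partial 0 x p.
Definition x_v x p : 'rV[R]_4 := partial 1 x p.

(* The row space of [tangent_mx x p] is the tangent plane at [p]. *)
Definition tangent_mx x p : 'M[R]_(2, 4) := \matrix_(i < 2) partial i x p.

Definition tangent x p (X : 'rV[R]_4) : Prop := (X <= tangent_mx x p)%MS.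

(* The row space of [normal_mx x p] is the normal space at [p]. *)
Definition normal_mx x p : 'M[R]_4 :=
  kermx (metric_mx R *m (tangent_mx x p)^T).

Lemma normal_mxP x p (n : 'rV[R]_4) :
  (n <= normal_mx x p)%MS <-> (forall X, tangent x p X -> sdot n X = 0).
Proof.
split=> [/sub_kermxP nT X /submxP[c ->]|nT].
  by rewrite /sdot trmx_mul mulmxA -(mulmxA n) nT mul0mx mxE.
apply/sub_kermxP/rowP => j; rewrite mulmxA [RHS]mxE -(nT _ (row_sub j _)).
by rewrite /sdot !mxE; apply: eq_bigr => k _; rewrite !mxE.
Qed.

(* Projection to the normal space along the tangent plane. *)
Definition normal_proj x p : 'M[R]_4 :=
  proj_mx (normal_mx x p) <<tangent_mx x p>>%MS.

Definition normal_part x p (w : 'rV[R]_4) : 'rV[R]_4 := w *m normal_proj x p.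

(* The linear extension of [normal_part] to double vectors, i.e. the projection
   to the span of the normal space along the span of the tangent plane, both
   spans being taken with double coefficients. *)
Definition normal_part_dn x p (w : 'rV[dnum R]_4) : 'rV[dnum R]_4 :=
  w *m map_mx (@dn_of R) (normal_proj x p).

(* Components [(a, b)] of a tangent vector [X = a x_u + b x_v]. *)
Definition tangent_coord x p (X : 'rV[R]_4) : 'rV[R]_2 :=
  X *m pinvmx (tangent_mx x p).

(* The second fundamental form [(D_X Y)^bot], the tangent vector [Y] being
   extended to the tangent field with the same, constant, components. *)
Definition sff x p (X Y : 'rV[R]_4) : 'rV[R]_4 :=
  normal_part x p
    ('D_(tangent_coord x p X) (fun q => 'D_(tangent_coord x p Y) x q) p).

Definition timelike_surface U x : Prop :=
  [/\ open U, connected U, smooth_on U x &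
      forall p, U p ->
        [/\ row_free (tangent_mx x p),
            exists X, tangent x p X /\ sdot X X < 0 &
            exists X, tangent x p X /\ 0 < sdot X X]].

Definition minimal_surface U x : Prop :=
  forall p, U p -> forall X1 X2 : 'rV[R]_4,
    tangent x p X1 -> tangent x p X2 ->
    sdot X1 X1 = -1 -> sdot X2 X2 = 1 -> sdot X1 X2 = 0 ->
    2^-1 *: (- sff x p X1 X1 + sff x p X2 X2) = 0.

Definition isothermal_coords U x : Prop :=
  forall p, U p ->
    sdot (x_u x p) (x_u x p) = - sdot (x_v x p) (x_v x p) /\
    sdot (x_u x p) (x_v x p) = 0.

Definition coef_E x p : R := sdot (x_u x p) (x_u x p).

Definition partial_dn (i : 'I_2) (F : 'rV[R]_2 -> 'rV[dnum R]_4)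
    (p : 'rV[R]_2) : 'rV[dnum R]_4 :=
  map_mx (@dn_of R) (partial i (fun q => map_mx (@dnRe R) (F q)) p)
  + dn_j *: map_mx (@dn_of R) (partial i (fun q => map_mx (@dnIm R) (F q)) p).

Definition partial_t (F : 'rV[R]_2 -> 'rV[dnum R]_4) (p : 'rV[R]_2) :
    'rV[dnum R]_4 :=
  dn_of 2^-1 *: (partial_dn 0 F p + dn_j *: partial_dn 1 F p).

Definition Phi x p : 'rV[dnum R]_4 :=
  map_mx (@dn_of R) (x_u x p) + dn_j *: map_mx (@dn_of R) (x_v x p).

Definition Phi'_bot x p : 'rV[dnum R]_4 :=
  normal_part_dn x p (partial_t (Phi x) p).

Definition Phi'_bot_sq x p : dnum R := sdot (Phi'_bot x p) (Phi'_bot x p).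

Definition general_type U x : Prop :=
  forall p, U p -> ~ dn_null (Phi'_bot_sq x p).

Inductive surface_type := FirstType | SecondType | ThirdType.

Definition of_surface_type (k : surface_type) U x : Prop :=
  forall p, U p ->
    match k with
    | FirstType => dn_pos (Phi'_bot_sq x p)
    | SecondType => dn_pos (- Phi'_bot_sq x p)
    | ThirdType => dn_pos (dn_j * Phi'_bot_sq x p) \/
                   dn_pos (- (dn_j * Phi'_bot_sq x p))
    end.

Definition type_eps (k : surface_type) : dnum R :=
  match k with FirstType => 1 | SecondType => -1 | ThirdType => dn_j end.

Definition canonical_coords U x : Prop :=
  [/\ isothermal_coords U x, forall p, U p -> coef_E x p < 0 &
      exists2 k, of_surface_type k U x &
                 forall p, U p -> Phi'_bot_sq x p = type_eps k].

End Surface.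

(* Main.v *)
From HB Require Import structures.
Require Import Defs.
From mathcomp Require Import all_boot all_order all_algebra.
From mathcomp Require Import all_classical all_reals all_analysis.
From mathcomp Require Import ring lra.
Import Order.TTheory GRing.Theory Num.Theory.
Import numFieldNormedType.Exports.
Local Open Scope classical_set_scope.
Local Open Scope ring_scope.

(** Write [N] for the projection to the normal space. In isothermal coordinates
    [2 Phi' = (x_uu + x_vv) + j (x_uv + x_vu)]. The frame
    [x_u / sqrt (- E)], [x_v / sqrt (- E)] is orthonormal, so minimality reads
    [N x_uu = N x_vv] ([minimal_normal_part]), and the mixed partial derivatives
    agree ([partial_comm]). Since [sigma (x_u, x_u) = N x_uu] and
    [sigma (x_u, x_v) = N x_uv] ([sff_coord]), it follows that
      [Phi'^bot = sigma (x_u, x_u) + j sigma (x_u, x_v)]   ([Phi'_botE]),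
    whose square has real part [sigma^2 (x_u, x_u) + sigma^2 (x_u, x_v)] and
    imaginary part [2 sigma (x_u, x_u) . sigma (x_u, x_v)] ([sdot_dn]). Setting
    these equal to the two components of [1], [-1] or [j] gives the three
    equivalences. A surface is canonical when the square is the constant of some
    type; the value of the square at any point determines the type
    ([type_eps_determined]), so this type is the given one.

    The equality of mixed derivatives is the classical theorem of Schwarz: the
    second difference of [f] over a small parallelogram is, by two applications
    of the mean value theorem, a value of either mixed derivative times the
    square of the side, and both mixed derivatives are continuous. *)

Set Implicit Arguments.
Unset Strict Implicit.
Unset Printing Implicit Defensive.

(** * Symmetry of mixed directional derivatives *)

Lemma is_derive_line (R : realType) (V W : normedModType R) (f : V -> W)
    (p v : V) (s : R) :
  derivable f (p + s *: v) v ->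
  is_derive s 1 (fun t : R => f (p + t *: v)) ('D_v f (p + s *: v)).
Proof.
have quotE : (fun h : R => h^-1 *: (f (p + (h *: 1 + s) *: v) - f (p + s *: v)))
    = (fun h => h^-1 *: (f (h *: v + (p + s *: v)) - f (p + s *: v))).
  apply/funext => h; congr (_ *: (f _ - _)).
  by rewrite [h *: 1]mulr1 scalerDl addrCA.
move=> fv; apply: DeriveDef.
  by rewrite /derivable /comp /shift /= quotE.
by rewrite /derive /comp /shift /= quotE.
Qed.

Lemma is_derive_translate (R : realType) (V W : normedModType R) (f : V -> W)
    (q c v : V) :
  derivable f (q + c) v ->
  is_derive q v (fun z => f (z + c)) ('D_v f (q + c)).
Proof.
have quotE : (fun t : R => t^-1 *: (f (t *: v + q + c) - f (q + c)))
    = (fun t => t^-1 *: (f (t *: v + (q + c)) - f (q + c))).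
  by apply/funext => t; rewrite addrA.
move=> fv; apply: DeriveDef.
  by rewrite /derivable /comp /shift /= quotE.
by rewrite /derive /comp /shift /= quotE.
Qed.

Lemma MVT_line (R : realType) (V : normedModType R) (f : V -> R) (p v : V)
    (h : R) :
  0 < h -> (forall a, a \in `[0, h] -> derivable f (p + a *: v) v) ->
  exists2 a, a \in `[0, h] & f (p + h *: v) - f p = 'D_v f (p + a *: v) * h.
Proof.
move=> h0 fv.
pose g (t : R) := f (p + t *: v).
pose dg (t : R) := 'D_v f (p + t *: v).
have g_cc a : a \in `[0, h] -> is_derive a 1 g (dg a).
  by move=> /fv /is_derive_line.
have g_oo a : a \in `]0, h[ -> is_derive a 1 g (dg a).
  by move=> /subset_itv_oo_cc; exact: g_cc.
have g_cont : {within `[0, h], continuous g}.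
  by apply: derivable_within_continuous => a /g_cc[].
have [a ah] := @MVT_segment R g dg _ _ (ltW h0) g_oo g_cont.
rewrite /g /dg => gE; exists a => //; move: gE.
by rewrite scale0r addr0 subr0.
Qed.

(** The second difference is the increment along [v] of the first difference
    along [w]; the mean value theorem turns it into [h] times a first difference
    of ['D_v f] along [w], and a second use into a mixed derivative. *)
Lemma second_difference (R : realType) (V : normedModType R) (f : V -> R)
    (p v w : V) (h : R) :
  0 < h ->
  (forall a b, a \in `[0, h] -> b \in `[0, h] ->
     derivable f (p + a *: v + b *: w) v /\
     derivable ('D_v f) (p + a *: v + b *: w) w) ->
  exists a b, [/\ a \in `[0, h], b \in `[0, h] &
    f (p + h *: v + h *: w) - f (p + h *: v) - (f (p + h *: w) - f p)
      = 'D_w ('D_v f) (p + a *: v + b *: w) * h * h].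
Proof.
move=> h0 fvw; pose g q := f (q + h *: w) - f q.
have h0h : h \in `[0, h] by rewrite in_itv /= lexx ltW.
have z0h : 0 \in `[0, h] by rewrite in_itv /= lexx ltW.
have gv a : a \in `[0, h] ->
    is_derive (p + a *: v) v g
      ('D_v f (p + a *: v + h *: w) - 'D_v f (p + a *: v)).
  move=> ah; have [fh _] := fvw _ _ ah h0h.
  have [+ _] := fvw _ _ ah z0h; rewrite scale0r addr0 => f0.
  by apply: is_deriveB; [exact: is_derive_translate | exact: derivableP].
have [a ah|a ah gE] := MVT_line h0 (f := g) (p := p) (v := v).
  by have [] := gv _ ah.
have [b bh|b bh fE] := MVT_line h0 (f := 'D_v f) (p := p + a *: v) (v := w).
  by have [] := fvw _ _ ah bh.
exists a, b; split => //; rewrite -fE.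
have [_ <-] := gv _ ah.
by rewrite -gE /g; ring.
Qed.

Lemma dist_common_le (R : realFieldType) (a b c e : R) :
  `|a - c| < e / 2 -> `|b - c| < e / 2 -> `|a - b| <= e.
Proof.
move=> /ltW ac /ltW bc; rewrite [e]splitr -(subrKA c a (- b)).
by rewrite (le_trans (ler_normD _ _))// lerD// distrC.
Qed.

(** Computing one second difference in both orders of [v] and [w] gives points
    arbitrarily close to [p] at which the two mixed derivatives take a common
    value. *)
Lemma scalar_derive_comm (R : realType) (V : normedModType R) (U : set V)
    (f : V -> R) (p v w : V) :
  open U -> U p ->
  (forall q, U q -> [/\ derivable f q v, derivable f q w,
     derivable ('D_v f) q w & derivable ('D_w f) q v]) ->
  {for p, continuous ('D_w ('D_v f))} -> {for p, continuous ('D_v ('D_w f))} ->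
  'D_w ('D_v f) p = 'D_v ('D_w f) p.
Proof.
move=> Uo Up fU cwv cvw; apply/eqP; rewrite -subr_eq0 -normr_le0.
apply/ler_addgt0Pl => e e0; rewrite addr0.
have e2 : 0 < e / 2 by rewrite divr_gt0.
have Un : \forall q \near p, U q by exact: open_nbhs_nbhs.
have near_wv : \forall q \near p,
    `|'D_w ('D_v f) p - 'D_w ('D_v f) q| < e / 2.
  by have /cvgrPdist_lt/(_ _ e2) := cwv.
have near_vw : \forall q \near p,
    `|'D_v ('D_w f) p - 'D_v ('D_w f) q| < e / 2.
  by have /cvgrPdist_lt/(_ _ e2) := cvw.
have Unear : \forall q \near p, [/\ U q,
    `|'D_w ('D_v f) p - 'D_w ('D_v f) q| < e / 2 &
    `|'D_v ('D_w f) p - 'D_v ('D_w f) q| < e / 2].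
  by apply: filterS3 Un near_wv near_vw => q.
move/nbhs_normP : Unear => [r /= r0 rU].
(* With this side the whole parallelogram lies in the ball of radius [r]; the
   [+ 1] covers the case where [v] and [w] both vanish. *)
pose h := r / (`|v| + `|w| + 1).
have D0 : 0 < `|v| + `|w| + 1 by rewrite ltr_pwDr// addr_ge0.
have h0 : 0 < h by rewrite divr_gt0.
have hn : h != 0 by rewrite gt_eqF.
have near_p a b : a \in `[0, h] -> b \in `[0, h] ->
    `|p - (p + a *: v + b *: w)| < r.
  rewrite !in_itv /= => /andP[a0 ah] /andP[b0 bh].
  rewrite -addrA opprD addrA subrr sub0r normrN.
  apply: (le_lt_trans (ler_normD _ _)).
  rewrite !normrZ !ger0_norm//.
  have -> : r = h * (`|v| + `|w| + 1) by rewrite /h mulfVK// gt_eqF.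
  by rewrite mulrDr mulr1 mulrDr ltr_pwDr// lerD// ler_wpM2r.
have near_p' b a (bh : b \in `[0, h]) (ah : a \in `[0, h]) :
    `|p - (p + b *: w + a *: v)| < r.
  by rewrite addrAC; exact: near_p.
have [a [b [ah bh E]]] := second_difference (f := f) (p := p) (v := v) (w := w)
  h0 (fun a b ah bh => let: And3 Uq _ _ := rU _ (near_p a b ah bh) in
     let: And4 fv _ fvw _ := fU _ Uq in conj fv fvw).
have [b' [a' [bh' ah']]] :=
  second_difference (f := f) (p := p) (v := w) (w := v)
  h0 (fun b a bh ah => let: And3 Uq _ _ := rU _ (near_p' b a bh ah) in
     let: And4 _ fw _ fwv := fU _ Uq in conj fw fwv).
rewrite [p + h *: w + h *: v]addrAC => E'.
have {E'}E : 'D_w ('D_v f) (p + a *: v + b *: w)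
    = 'D_v ('D_w f) (p + b' *: w + a' *: v).
  apply: (mulIf hn); apply: (mulIf hn).
  by apply: (etrans (esym E)); apply: (etrans _ E'); ring.
have [_ AC _] := rU _ (near_p a b ah bh).
have [_ _ BC] := rU _ (near_p' b' a' bh' ah').
by apply: (dist_common_le AC); rewrite E.
Qed.

Lemma derive_comm (R : realType) (V : normedModType R) (m n : nat) (U : set V)
    (f : V -> 'M[R]_(m, n)) (p v w : V) :
  open U -> U p ->
  (forall q, U q -> [/\ derivable f q v, derivable f q w,
     derivable ('D_v f) q w & derivable ('D_w f) q v]) ->
  {for p, continuous ('D_w ('D_v f))} -> {for p, continuous ('D_v ('D_w f))} ->
  'D_w ('D_v f) p = 'D_v ('D_w f) p.
Proof.
move=> Uo Up fU cwv cvw; apply/matrixP => i j.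
pose g q := f q i j.
have D1 u q : derivable f q u -> 'D_u f q i j = 'D_u g q.
  by move=> fu; rewrite derive_mx// mxE.
have nearU q (Uq : U q) : \forall z \near q, U z by exact: open_nbhs_nbhs.
have D2 u u' : (forall q, U q -> derivable f q u /\ derivable ('D_u f) q u') ->
    forall q, U q -> derivable ('D_u g) q u' /\
      'D_u' ('D_u f) q i j = 'D_u' ('D_u g) q.
  move=> fu q Uq; have [_ fuu'] := fu q Uq.
  have eq_near : \forall z \near q, 'D_u f z i j = 'D_u g z.
    by near=> z; apply: D1; apply: (fu _ _).1; near: z; exact: nearU.
  split; last by rewrite derive_mx// mxE; exact: near_eq_derive.
  by apply: near_eq_derivable eq_near _; move/derivable_mxP : fuu'; exact.
have Dvw := D2 v w (fun q Uq => let: And4 a _ b _ := fU q Uq in conj a b).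
have Dwv := D2 w v (fun q Uq => let: And4 _ a _ b := fU q Uq in conj a b).
have cont u u' : (forall q, U q -> 'D_u' ('D_u f) q i j = 'D_u' ('D_u g) q) ->
    {for p, continuous ('D_u' ('D_u f))} ->
    {for p, continuous ('D_u' ('D_u g))}.
  move=> E c; rewrite /prop_for /continuous_at -E//.
  have : (fun q => 'D_u' ('D_u f) q i j) @ p --> 'D_u' ('D_u f) p i j.
    exact: (cvg_comp _ _ c (@coord_continuous _ _ _ i j _)).
  apply: cvg_trans; apply: near_eq_cvg; near=> q; apply: E; near: q.
  exact: nearU.
apply: (etrans (Dvw _ Up).2); apply: (etrans _ (esym (Dwv _ Up).2)).
apply: (scalar_derive_comm Uo Up).
- move=> q Uq; have [fv fw _ _] := fU q Uq; split.
  + by move/derivable_mxP : fv; exact.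
  + by move/derivable_mxP : fw; exact.
  + exact: (Dvw _ Uq).1.
  + exact: (Dwv _ Uq).1.
- by apply: cont cwv => q /Dvw[].
- by apply: cont cvw => q /Dwv[].
Unshelve. all: by end_near.
Qed.

(** * Double numbers and double vectors *)

Section DoubleVectors.
Variable R : comNzRingType.

Lemma dn_of_zmod_morphism : zmod_morphism (@dn_of R).
Proof. by move=> a b; congr Dnum; rewrite /= subr0. Qed.

Lemma dn_of_monoid_morphism : monoid_morphism (@dn_of R).
Proof. by split=> // a b; congr Dnum; rewrite /= ?mulr0 ?mul0r !addr0. Qed.

HB.instance Definition _ :=
  GRing.isZmodMorphism.Build R (dnum R) (@dn_of R) dn_of_zmod_morphism.
HB.instance Definition _ :=
  GRing.isMonoidMorphism.Build R (dnum R) (@dn_of R) dn_of_monoid_morphism.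

Definition dn_vec m n (a b : 'M[R]_(m, n)) : 'M[dnum R]_(m, n) :=
  map_mx (@dn_of R) a + dn_j *: map_mx (@dn_of R) b.

Lemma dn_vecE m n (a b : 'M[R]_(m, n)) i k :
  dn_vec a b i k = Dnum (a i k) (b i k).
Proof. by rewrite !mxE; congr Dnum; rewrite /=; ring. Qed.

Lemma map_dnRe_vec m n (a b : 'M[R]_(m, n)) :
  map_mx (@dnRe R) (dn_vec a b) = a.
Proof. by apply/matrixP => i k; rewrite mxE dn_vecE. Qed.

Lemma map_dnIm_vec m n (a b : 'M[R]_(m, n)) :
  map_mx (@dnIm R) (dn_vec a b) = b.
Proof. by apply/matrixP => i k; rewrite mxE dn_vecE. Qed.

Lemma sdot_dn (a b : 'rV[R]_4) :
  sdot (dn_vec a b) (dn_vec a b)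
    = Dnum (sdot a a + sdot b b) (2 * sdot a b).
Proof. by rewrite !sdotE !dn_vecE; congr Dnum; rewrite /=; ring. Qed.

End DoubleVectors.

Lemma dn_half_add (R : realType) : dn_of 2^-1 + dn_of 2^-1 = 1 :> dnum R.
Proof. by rewrite -rmorphD /= -[2^-1]mul1r -splitr rmorph1. Qed.

(** With [s = 1 / 2] and [t = j] the left side is the projection by [P] of
    [d Phi / dt], where [a], [b], [d] are the second derivatives [x_uu], [x_uv],
    [x_vv]. Since [t ^+ 2 = 1] and [a], [d] have the same projection, the two
    summands project to the same vector, of which the left side is the mean. *)
Lemma mulmx_d_dbar (K : comNzRingType) m n k (P : 'M[K]_(n, k)) (s t : K)
    (a b d : 'M[K]_(m, n)) :
  s + s = 1 -> t ^+ 2 = 1 -> a *m P = d *m P ->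
  (s *: ((a + t *: b) + t *: (b + t *: d))) *m P = a *m P + t *: (b *m P).
Proof.
move=> ss tt ad; rewrite -scalemxAl mulmxDl -scalemxAl !mulmxDl -!scalemxAl -ad.
rewrite [t *: (_ + _)]scalerDr scalerA -expr2 tt scale1r.
by rewrite [t *: _ + _]addrC scalerDr -scalerDl ss scale1r.
Qed.

Lemma dn_d_dbar (R : realType) m n k (P : 'M[R]_(n, k))
    (a b b' d : 'M[R]_(m, n)) :
  b' = b -> a *m P = d *m P ->
  (dn_of 2^-1 *: (dn_vec a b + dn_j *: dn_vec b' d)) *m map_mx (@dn_of R) P
  = dn_vec (a *m P) (b *m P).
Proof.
move=> -> adP; rewrite /dn_vec !map_mxM; apply: mulmx_d_dbar.
- exact: dn_half_add.
- exact: dn_jj.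
by rewrite -!map_mxM adP.
Qed.

(** * Second fundamental form in coordinates *)

Section Surface.
Variables (R : realType) (U : set 'rV[R]_2) (x : 'rV[R]_2 -> 'rV[R]_4).

Lemma partial_comm p (i j : 'I_2) : open U -> smooth_on U x -> U p ->
  partial i (partial j x) p = partial j (partial i x) p.
Proof.
move=> Uo xs Up; apply: (derive_comm Uo Up).
- move=> q Uq; split; apply: diff_derivable.
  + exact: (xs [::] _ Uq).
  + exact: (xs [::] _ Uq).
  + exact: (xs [:: j] _ Uq).
  + exact: (xs [:: i] _ Uq).
- exact: (differentiable_continuous (xs [:: i; j] _ Up)).
- exact: (differentiable_continuous (xs [:: j; i] _ Up)).
Qed.

Lemma tangent_coord_partial p (a : R) (i : 'I_2) : row_free (tangent_mx x p) ->
  tangent_coord x p (a *: partial i x p) = a *: delta_mx 0 i.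
Proof.
move=> Tfree; rewrite /tangent_coord.
have -> : partial i x p = delta_mx 0 i *m tangent_mx x p.
  by rewrite -rowE rowK.
by rewrite scalemxAl mulmxKp.
Qed.

(** Directional derivatives of differentiable maps are linear in the direction,
    so both scalars come out; the inner derivative is rewritten at all points
    near [p], since the outer one depends on them. *)
Lemma sff_coord p (X Y : 'rV[R]_4) (a b : R) (i j : 'I_2) :
  open U -> smooth_on U x -> U p ->
  tangent_coord x p X = a *: delta_mx 0 i ->
  tangent_coord x p Y = b *: delta_mx 0 j ->
  sff x p X Y = (a * b) *: normal_part x p (partial i (partial j x) p).
Proof.
move=> Uo xs Up Xa Yb; rewrite /sff Xa Yb.
have DZ (V : normedModType R) (f : _ -> V) q c (k : 'I_2) :
    differentiable f q -> 'D_(c *: delta_mx 0 k) f q = c *: partial k f q.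
  by move=> df; rewrite /partial !deriveE// linearZ.
have -> : 'D_(a *: delta_mx 0 i) (fun q => 'D_(b *: delta_mx 0 j) x q) p
    = 'D_(a *: delta_mx 0 i) (b \*: partial j x) p.
  apply: near_eq_derive; near=> q; apply: DZ; apply: (xs [::]).
  near: q; exact: open_nbhs_nbhs.
have dj : differentiable (partial j x) p by exact: (xs [:: j]).
rewrite DZ; last exact: differentiableZ.
rewrite /partial deriveZ; last exact: diff_derivable.
by rewrite /normal_part scalerA -scalemxAl.
Unshelve. all: by end_near.
Qed.

Lemma scaled_diff_eq0 (V : lmodType R) (k : R) (a b : V) : k != 0 ->
  2^-1 *: (- (k *: a) + k *: b) = 0 -> a = b.
Proof.
move=> k0 /eqP; rewrite scaler_eq0 invr_eq0 pnatr_eq0 /= -scalerN -scalerDr.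
by rewrite scaler_eq0 (negbTE k0) /= addrC subr_eq0 => /eqP.
Qed.

(** Minimality, applied to the normalized coordinate frame, whose two vectors
    carry the same factor [1 / sqrt (- E)]. *)
Lemma minimal_normal_part p :
  timelike_surface U x -> minimal_surface U x -> isothermal_coords U x ->
  U p -> coef_E x p < 0 ->
  normal_part x p (partial 0 (partial 0 x) p)
    = normal_part x p (partial 1 (partial 1 x) p).
Proof.
move=> [Uo _ xs Ut] xmin xiso Up E0; have [Tfree _ _] := Ut _ Up.
have [uv uv0] := xiso _ Up.
pose c := (Num.sqrt (- coef_E x p))^-1.
have c2 : c * c = - (coef_E x p)^-1.
  by rewrite -invfM -expr2 sqr_sqrtr ?invrN// oppr_ge0 ltW.
have En0 : coef_E x p != 0 by rewrite lt_eqF.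
have tan i : tangent x p (c *: partial i x p).
  by apply: scalemx_sub; rewrite -(rowK (fun i => partial i x p)) row_sub.
have sZ (a b : 'rV[R]_4) : sdot (c *: a) (c *: b) = c * c * sdot a b.
  by rewrite !sdotE !mxE; ring.
have vv : sdot (partial 1 x p) (partial 1 x p) = - coef_E x p.
  exact: (etrans (esym (opprK _)) (congr1 -%R (esym uv))).
have X1 : sdot (c *: partial 0 x p) (c *: partial 0 x p) = -1.
  by rewrite sZ c2 mulNr mulVf.
have X2 : sdot (c *: partial 1 x p) (c *: partial 1 x p) = 1.
  by rewrite sZ c2 vv mulrNN mulVf.
have X12 : sdot (c *: partial 0 x p) (c *: partial 1 x p) = 0.
  by rewrite sZ uv0 mulr0.
have sE i : sff x p (c *: partial i x p) (c *: partial i x p)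
    = (c * c) *: normal_part x p (partial i (partial i x) p).
  have ci := tangent_coord_partial c i Tfree.
  exact: (sff_coord Uo xs Up ci ci).
have := xmin _ Up _ _ (tan 0) (tan 1) X1 X2 X12.
rewrite [X in _ *: (- X + _)](sE 0) [X in _ *: (_ + X)](sE 1) c2.
by apply: scaled_diff_eq0; rewrite oppr_eq0 invr_eq0.
Qed.

Lemma partial_dn_Phi p i : partial_dn i (Phi x) p =
  dn_vec (partial i (partial 0 x) p) (partial i (partial 1 x) p).
Proof.
have ReE : (fun q => map_mx (@dnRe R) (Phi x q)) = partial 0 x.
  by apply/funext => q; exact: map_dnRe_vec.
have ImE : (fun q => map_mx (@dnIm R) (Phi x q)) = partial 1 x.
  by apply/funext => q; exact: map_dnIm_vec.
by rewrite /partial_dn ReE ImE.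
Qed.

Lemma Phi'_botE p :
  timelike_surface U x -> minimal_surface U x -> isothermal_coords U x ->
  U p -> coef_E x p < 0 ->
  Phi'_bot x p = dn_vec (sff x p (x_u x p) (x_u x p))
                        (sff x p (x_u x p) (x_v x p)).
Proof.
move=> xt xmin xiso Up E0; have [Uo _ xs Ut] := xt; have [Tfree _ _] := Ut _ Up.
have one_act (w : 'rV[R]_4) : (1 * 1) *: w = w by rewrite mulr1 scale1r.
have coord i : tangent_coord x p (partial i x p) = 1 *: delta_mx 0 i.
  rewrite -(tangent_coord_partial 1 i Tfree).
  by congr tangent_coord; exact: (esym (scale1r _)).
have sE i j : sff x p (partial i x p) (partial j x p)
    = normal_part x p (partial i (partial j x) p).
  exact: (etrans (sff_coord Uo xs Up (coord i) (coord j)) (one_act _)).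
rewrite /Phi'_bot /normal_part_dn /partial_t partial_dn_Phi partial_dn_Phi.
apply: (etrans (dn_d_dbar (partial_comm 1 0 Uo xs Up)
                          (minimal_normal_part xt xmin xiso Up E0))).
exact: (congr2 (@dn_vec R 1 4) (esym (sE 0 0)) (esym (sE 0 1))).
Qed.

(** * Canonical coordinates *)

(** The positive cones of [1], [-1], [j] and [-j] are disjoint, and no two of
    the constants lie in the cones of one type. *)
Lemma type_eps_determined (k l : surface_type) :
  match k with
  | FirstType => dn_pos (type_eps R l)
  | SecondType => dn_pos (- type_eps R l)
  | ThirdType => dn_pos (dn_j * type_eps R l) \/
                 dn_pos (- (dn_j * type_eps R l))
  end -> l = k.
Proof.
have posE a b : dn_pos (Dnum a b) -> 0 < a ^+ 2 - b ^+ 2 /\ 0 < a by [].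
by case: k; case: l => //=; (case=> [/posE|/posE] || move/posE) => -[n0 a0];
   exfalso; move: n0 a0; rewrite /=; lra.
Qed.

(** Over an empty domain every type is a type of the surface, and both sides
    hold. *)
Lemma canonical_coordsP k :
  isothermal_coords U x -> (forall p, U p -> coef_E x p < 0) ->
  of_surface_type k U x ->
  (canonical_coords U x <->
   forall p, U p -> Phi'_bot_sq x p = type_eps R k).
Proof.
move=> xiso E0 xk.
split=> [[_ _ [l _ sqE]] p Up|sqE]; last by split=> //; exists k.
by have := xk _ Up; rewrite sqE// => /type_eps_determined ->.
Qed.

End Surface.

Unset Implicit Arguments.

Theorem proposition6p5 (R : realType) (U : set 'rV[R]_2)
    (x : 'rV[R]_2 -> 'rV[R]_4)
    (Msurf : timelike_surface U x) (Mmin : minimal_surface U x)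
    (Mgen : general_type U x)
    (Miso : isothermal_coords U x) (Eneg : forall p, U p -> coef_E x p < 0) :
  let s_uu := fun p => sff x p (x_u x p) (x_u x p) in
  let s_uv := fun p => sff x p (x_u x p) (x_v x p) in
  [/\ of_surface_type FirstType U x ->
        (canonical_coords U x <->
         forall p, U p ->
           sdot (s_uu p) (s_uv p) = 0 /\
           sdot (s_uu p) (s_uu p) + sdot (s_uv p) (s_uv p) = 1),
      of_surface_type SecondType U x ->
        (canonical_coords U x <->
         forall p, U p ->
           sdot (s_uu p) (s_uv p) = 0 /\
           sdot (s_uu p) (s_uu p) + sdot (s_uv p) (s_uv p) = -1) &
      of_surface_type ThirdType U x ->
        (canonical_coords U x <->
         forall p, U p ->
           2 * sdot (s_uu p) (s_uv p) = 1 /\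
           sdot (s_uu p) (s_uu p) + sdot (s_uv p) (s_uv p) = 0)].
Proof.
move=> s_uu s_uv.
have sqE p : U p -> Phi'_bot_sq x p =
    Dnum (sdot (s_uu p) (s_uu p) + sdot (s_uv p) (s_uv p))
         (2 * sdot (s_uu p) (s_uv p)).
  move=> Up; rewrite /Phi'_bot_sq (Phi'_botE Msurf Mmin Miso Up (Eneg _ Up)).
  exact: sdot_dn.
have canonicalE k (P : R -> R -> Prop) :
    (forall a b, Dnum a (2 * b) = type_eps R k <-> P a b) ->
    of_surface_type k U x ->
    (canonical_coords U x <-> forall p, U p ->
       P (sdot (s_uu p) (s_uu p) + sdot (s_uv p) (s_uv p))
         (sdot (s_uu p) (s_uv p))).
  move=> kP xk; apply: iff_trans (canonical_coordsP Miso Eneg xk) _.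
  by split=> H p Up; move: (H p Up); rewrite (sqE _ Up); apply kP.
have double_eq0 (b : R) : 2 * b = 0 -> b = 0 by lra.
split.
- apply: (canonicalE FirstType (fun a b => b = 0 /\ a = 1)) => a b.
  split=> [[-> /double_eq0] // | [-> ->]].
  by congr Dnum; rewrite mulr0.
- apply: (canonicalE SecondType (fun a b => b = 0 /\ a = -1)) => a b.
  split=> [[-> ] | [-> ->]]; first by rewrite oppr0 => /double_eq0.
  by congr Dnum; rewrite /= mulr0 ?oppr0.
- apply: (canonicalE ThirdType (fun a b => 2 * b = 1 /\ a = 0)) => a b.
  by split=> [[-> ->] | [-> ->]].
Qed.
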